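(* Let $p$ and $q$ be real numbers with $p>q\ge2$, and let $L_p=L_p(\mu)$ and $L_q=L_q(\nu)$ be infinite-dimensional, where $\mu$ and $\nu$ are measures on (possibly different) measurable spaces. Then $\mathcal{CR}(L_p,L_q)\le 30$.
   Context: For metric spaces $(M_1,d_1)$, $(M_2,d_2)$ and an arbitrary (not necessarily continuous) map $\phi: M_1\to M_2$, define for $t\in(0,\infty)$ $$\kappa_\phi(t)=\inf_{d_1(x,y)\ge t} d_2(\phi(x),\phi(y)),\qquad \omega_\phi(t)=\sup_{d_1(x,y)\le t} d_2(\phi(x),\phi(y)),$$ with values in $[0,\infty]$, and $\kappa(\phi)=\sup_{t<\infty}\kappa_\phi(t)$, $\omega(\phi)=\inf_{t>0}\omega_\phi(t)$. The separation ratio of $\phi$ is $\mathcal{R}(\phi)=\kappa(\phi)/\omega(\phi)\in[0,\infty]$, with the conventions $\frac{a}{\infty}=\frac{0}{a}=0$ for all $a\in[0,\infty]$ and $\frac{a}{0}=\frac{\infty}{a}=\frac{\infty}{0}=\infty$ for all $a\in(0,\infty)$. The coarse embeddability ratio is $\mathcal{CR}(M_1,M_2)=\sup_\phi \mathcal{R}(\phi)$, the supremum over all maps $\phi:M_1\to M_2$. Banach spaces carry their norm metric; $L_p$ spaces consist of real-valued functions. *)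

(* Defs.v *)
From HB Require Import structures.
From mathcomp Require Import all_boot all_order all_algebra.
From mathcomp Require Import all_classical all_reals all_analysis.
From mathcomp Require Import measurable_realfun ess_sup_inf.

Set Implicit Arguments.
Unset Strict Implicit.
Unset Printing Implicit Defensive.

Import Order.TTheory GRing.Theory Num.Theory.
Import numFieldNormedType.Exports.

Local Open Scope classical_set_scope.
Local Open Scope ring_scope.

Section Lspace_normedModType.
Context d (T : measurableType d) (R : realType).
Variables (mu : {measure set T -> \bar R}) (p : \bar R) (p1 : (1 <= p)%E).
Notation Lf := (LfunType mu p1).
Notation Ls := (LspaceType mu p1).

Lemma ae_eq_Lnorm (f g : T -> R) :
  measurable_fun [set: T] f -> measurable_fun [set: T] g ->
  f = g %[ae mu] -> ('N[mu]_p[EFin \o f] = 'N[mu]_p[EFin \o g])%E.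
Proof.
move=> mf mg fg; rewrite unlock; case: p p1 => [r r1|_|//] /=.
- have mpow (h : T -> R) : measurable_fun [set: T] h ->
      measurable_fun [set: T] (fun x => (`|h x| `^ r)%:E).
    move=> mh.
    apply/measurable_EFinP/(measurableT_comp (measurable_powR _)) => //.
    exact: measurableT_comp.
  congr (_ `^ _)%E; apply: ae_eq_integral => //; [exact: mpow|exact: mpow|].
  by apply: filterS fg => x fg Dx /=; rewrite fg.
- case: ifPn => // mu0; apply: eq_ess_sup.
  by apply: filterS fg => x /= fg; rewrite fg.
Qed.

Lemma measurable_Lspace (f : {mfun_ mu, T >-> measurableTypeR R}) :
  measurable_fun [set: T] (f : T -> R).
Proof. exact: (measurable_funPT (repr f)). Qed.

Section class.
Variable f : Lf.

(* the codomain of the functions in [LspaceType] is [measurableTypeR R], which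
   only shares its carrier and its measurable sets with [R] *)
Let f' : {mfun T >-> measurableTypeR R} :=
  HB.pack (f : T -> measurableTypeR R)
    (isMeasurableFun.Build _ _ T (measurableTypeR R) f
      (measurable_funPT (f : {mfun T >-> R}))).

Let fT : {mfun_ mu, T >-> measurableTypeR R} := (\pi f')%qT.

Let repr_pi : (fT : T -> R) = f %[ae mu].
Proof.
apply/asboolP; rewrite -[`[< _ >]]/(ae_eq_op_canonical _ mu (repr fT) f').
by rewrite -eqmodE; apply/eqP; exact: reprK.
Qed.

Let finite_fT : finite_norm mu p (fT : T -> R).
Proof.
rewrite /finite_norm (ae_eq_Lnorm (measurable_Lspace fT) _ repr_pi)//.
exact: Lfunction_finite.
Qed.

HB.instance Definition _ := isFinLebesgue.Build d T R mu p p1 fT finite_fT.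

Definition Lclass : Ls := fT.

Lemma LclassE : (Lclass : T -> R) = f %[ae mu].
Proof. exact: repr_pi. Qed.

End class.

Lemma Lspace_inj (f g : Ls) : (f : T -> R) = g %[ae mu] -> f = g.
Proof.
case: f g => [f [[hf]]] [g [[hg]]] /= fg.
have fg' : f = g by apply/eqP; rewrite -[f]reprK -[g]reprK; apply/ae_eqP.
by rewrite {}fg' in hf *; rewrite (bool_irrelevance hf hg).
Qed.

Lemma Lrepr_subproof (f : Ls) : (f : T -> R) \in Lfun mu p.
Proof.
apply/andP; split; rewrite inE /=.
  exact: measurable_Lspace.
exact: Lebesgue_finite.
Qed.

Definition Lrepr (f : Ls) : Lf := Lfun_Sub p1 (Lrepr_subproof f).

Lemma LreprK : cancel Lrepr Lclass.
Proof. by move=> f; apply: Lspace_inj; apply: LclassE. Qed.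

Lemma eq_Lclass (f g : Lf) : (f : T -> R) = g %[ae mu] -> Lclass f = Lclass g.
Proof.
move=> fg; apply: Lspace_inj; apply: ae_eq_trans (LclassE f) _.
by apply: ae_eq_trans fg _; apply/ae_eq_sym/LclassE.
Qed.

Definition Lspace_zero : Ls := Lclass 0.
Definition Lspace_opp (f : Ls) : Ls := Lclass (- Lrepr f).
Definition Lspace_add (f g : Ls) : Ls := Lclass (Lrepr f + Lrepr g).
Definition Lspace_scale (a : R) (f : Ls) : Ls := Lclass (a *: Lrepr f).
Definition Lspace_norm (f : Ls) : R := fine ('N[mu]_p[EFin \o f])%E.

Lemma Lclass_opp f : Lspace_opp (Lclass f) = Lclass (- f).
Proof.
apply: eq_Lclass; apply: filterS (LclassE f) => x fx Dx.
exact: (congr1 -%R (fx Dx)).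
Qed.

Lemma Lclass_add f g : Lspace_add (Lclass f) (Lclass g) = Lclass (f + g).
Proof.
apply: eq_Lclass; apply: filterS2 (LclassE f) (LclassE g) => x fx gx Dx.
exact: (congr2 +%R (fx Dx) (gx Dx)).
Qed.

Lemma Lclass_scale a f : Lspace_scale a (Lclass f) = Lclass (a *: f).
Proof.
apply: eq_Lclass; apply: filterS (LclassE f) => x fx Dx.
exact: (congr1 ( *%R a) (fx Dx)).
Qed.

Lemma Lclass_norm (f : Lf) :
  Lspace_norm (Lclass f) = fine ('N[mu]_p[EFin \o f])%E.
Proof.
congr fine; apply: ae_eq_Lnorm (LclassE f); first exact: measurable_Lspace.
exact: (measurable_funPT (f : {mfun T >-> R})).
Qed.

Let addA : associative Lspace_add.
Proof.
move=> f g h; rewrite -[f]LreprK -[g]LreprK -[h]LreprK.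
by rewrite !Lclass_add addrA.
Qed.

Let addC : commutative Lspace_add.
Proof. by move=> f g; rewrite /Lspace_add addrC. Qed.

Let add0 : left_id Lspace_zero Lspace_add.
Proof. by move=> f; rewrite -[f]LreprK Lclass_add add0r. Qed.

Let addN : left_inverse Lspace_zero Lspace_opp Lspace_add.
Proof. by move=> f; rewrite -[f]LreprK Lclass_opp Lclass_add addNr. Qed.

HB.instance Definition _ := gen_eqMixin Ls.
HB.instance Definition _ := gen_choiceMixin Ls.
HB.instance Definition _ := GRing.isZmodule.Build Ls addA addC add0 addN.

Let scaleA a b f : Lspace_scale a (Lspace_scale b f) = Lspace_scale (a * b) f.
Proof. by rewrite -[f]LreprK !Lclass_scale scalerA. Qed.

Let scale1 : left_id 1 Lspace_scale.
Proof. by move=> f; rewrite -[f]LreprK Lclass_scale scale1r. Qed.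

Let scaleDr : right_distributive Lspace_scale +%R.
Proof.
move=> a f g; rewrite -[f]LreprK -[g]LreprK.
rewrite -[X in Lspace_scale a X]/(Lspace_add _ _) -[RHS]/(Lspace_add _ _).
by rewrite Lclass_add !Lclass_scale Lclass_add scalerDr.
Qed.

Let scaleDl f : {morph Lspace_scale^~ f : a b / a + b}.
Proof.
move=> a b; rewrite -[f]LreprK !Lclass_scale -[RHS]/(Lspace_add _ _).
by rewrite Lclass_add scalerDl.
Qed.

HB.instance Definition _ :=
  GRing.Zmodule_isLmodule.Build R Ls scaleA scale1 scaleDr scaleDl.

Let normD f g : Lspace_norm (f + g) <= Lspace_norm f + Lspace_norm g.
Proof.
rewrite -[f]LreprK -[g]LreprK -[_ + _ in leLHS]/(Lspace_add _ _) Lclass_add.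
by rewrite !Lclass_norm; exact: ler_LnormD.
Qed.

Let normZ a f : Lspace_norm (a *: f) = `|a| * Lspace_norm f.
Proof.
rewrite -[f]LreprK -[_ *: _]/(Lspace_scale _ _) Lclass_scale !Lclass_norm.
by rewrite (LnormZ (Lrepr f) a) -finite_norm_fine -EFinM.
Qed.

Let norm0 f : Lspace_norm f = 0 -> f = 0.
Proof.
rewrite -[f]LreprK Lclass_norm => /fine_Lnormr_eq0 f0.
exact: eq_Lclass.
Qed.

HB.instance Definition _ :=
  Lmodule_isNormed.Build R Ls normD normZ norm0.

Let dist (f g : Ls) : R := `|f - g|.

Let dist_ge0 f g : 0 <= dist f g. Proof. exact: normr_ge0. Qed.

Let dist_positivity f g : dist f g = 0 -> f = g.
Proof. by move/normr0_eq0/subr0_eq. Qed.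

Let ball_dist f e : ball f e = [set g | dist f g < e].
Proof. by []. Qed.

HB.instance Definition _ := @PseudoMetric_isMetric.Build R Ls dist dist_ge0
  dist_positivity ball_dist.

Lemma EFin_Lspace_mdist (f g : Ls) :
  ((mdist f g)%:E = 'N[mu]_p[(fun x => (f x - g x)%R%:E)])%E.
Proof.
have -> : mdist f g = Lspace_norm (Lclass (Lrepr f - Lrepr g)).
  congr Lspace_norm; rewrite -[LHS]/(Lspace_add f (Lspace_opp g)).
  by rewrite -[f in LHS]LreprK Lclass_add.
by rewrite Lclass_norm finite_norm_fine.
Qed.

End Lspace_normedModType.

Section dimension.
Context (K : fieldType) (V : lmodType K).

Definition finite_dimensional : Prop :=
  exists (n : nat) (e : 'I_n -> V),
    forall v : V, exists c : 'I_n -> K, v = \sum_(i < n) c i *: e i.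

Definition infinite_dimensional : Prop := ~ finite_dimensional.

End dimension.

Section coarse_embeddability_ratio.
Context (R : realType) (M1 M2 : metricType R).
Local Open Scope ereal_scope.
Implicit Type phi : M1 -> M2.

Definition kappa_fun phi (t : R) : \bar R := ereal_inf
  [set (mdist (phi xy.1) (phi xy.2))%:E |
     xy in [set xy : M1 * M1 | (t <= mdist xy.1 xy.2)%R]].

(* [ereal_sup set0] is [-oo], so that the [[0, +oo]]-valued supremum of the
   definition is obtained for an inhabited [M1] *)
Definition omega_fun phi (t : R) : \bar R := ereal_sup
  [set (mdist (phi xy.1) (phi xy.2))%:E |
     xy in [set xy : M1 * M1 | (mdist xy.1 xy.2 <= t)%R]].

Definition kappa phi : \bar R :=
  ereal_sup [set kappa_fun phi t | t in [set t : R | (0 < t)%R]].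

Definition omega phi : \bar R :=
  ereal_inf [set omega_fun phi t | t in [set t : R | (0 < t)%R]].

(* on [[0, +oo]], the library's division is such that [a / +oo = 0 / a = 0] for
   all [a], and [a / 0 = +oo / a = +oo / 0 = +oo] for [0 < a < +oo] *)
Definition separation_ratio phi : \bar R := kappa phi / omega phi.

Definition CR : \bar R := ereal_sup (range separation_ratio).

End coarse_embeddability_ratio.
Arguments CR {R} M1 M2.

Lemma le2_lee1 (R : realType) (r : R) : 2 <= r -> (1 <= r%:E)%E.
Proof. by rewrite lee_fin; apply: le_trans; rewrite ler1n. Qed.

(* Main.v *)
(** Let [f x = phi (c * \sum_j x_j u_j)], with [u_1, ..., u_n] disjointly
    supported unit vectors of [L_p] and [c = delta / n^(1/p)], so that moving by
    a sign vector [eps] moves [f] by at most [w]. Applying Bessel's inequality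
    for the Rademacher functions and the power mean inequality to the scalar
    values, then integrating, the means [D_j y] of [eps_j (f (y + eps) - f y)]
    satisfy [\sum_j |D_j y|^q <= w^q] in [L_q]. Since [D_j] is the increment in
    the [j]-th direction of a local average of [f], summing it along a line
    yields [f (x + 2 M e_j) - f x] up to [O(w)]; averaging over [j] and over the
    box of side [M] gives a line on which that sum is [O(w)], as soon as
    [M <= n^(1/q)]. The two end points are [2 M c >= delta n^(1/q - 1/p)] apart,
    which is unbounded. *)

Require Import Defs.
From mathcomp Require Import all_boot all_order all_algebra.
From mathcomp Require Import all_classical all_reals all_analysis.
From mathcomp Require Import measurable_realfun ring lra.

Import Order.TTheory GRing.Theory Num.Theory.
Import numFieldNormedType.Exports.

Local Open Scope classical_set_scope.
Local Open Scope ring_scope.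

Set Implicit Arguments.
Unset Strict Implicit.
Unset Printing Implicit Defensive.

(** * Sign vectors and flipping one sign *)

Section flip.
Context {n : nat}.
Implicit Types (eps : {ffun 'I_n -> bool}) (j : 'I_n).

Definition flip j eps : {ffun 'I_n -> bool} := [ffun i => eps i (+) (i == j)].

Lemma flipK j : involutive (flip j).
Proof. by move=> eps; apply/ffunP => i; rewrite !ffunE -addbA addbb addbF. Qed.

Lemma flip_diag j eps : flip j eps j = ~~ eps j.
Proof. by rewrite ffunE eqxx addbT. Qed.

Lemma flip_off i j eps : i != j -> flip j eps i = eps i.
Proof. by move=> /negPf ij; rewrite ffunE ij addbF. Qed.

(** This pairing serves three times: it writes [D j] as a difference of half-cube sums, counts the
    half cube, and cancels the off-diagonal products of signs. *)
Lemma sum_flip (A : nmodType) j (G : {ffun 'I_n -> bool} -> A) :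
  \sum_eps G eps =
  \sum_(eps : {ffun 'I_n -> bool} | eps j) (G (flip j eps) + G eps).
Proof.
rewrite big_split/= (bigID (fun eps : {ffun 'I_n -> bool} => ~~ eps j))/=.
congr +%R; last by apply: eq_bigl => eps; rewrite negbK.
rewrite (reindex_inj (inv_inj (flipK j)))/=.
by apply: eq_bigl => eps; rewrite flip_diag negbK.
Qed.

(** The value [true] encodes the sign $-1$, in agreement with the scalars [(-1) ^+ eps j]. *)
Definition signed_sum (V : zmodType) (e : 'I_n -> V) eps : V :=
  \sum_i (if eps i then - e i else e i).

Lemma signed_sum_flip (V : zmodType) (e : 'I_n -> V) j eps : eps j ->
  signed_sum e (flip j eps) = signed_sum e eps + e j *+ 2.
Proof.
move=> epsj; rewrite /signed_sum (bigD1 j)//= [in RHS](bigD1 j)//=.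
rewrite flip_diag epsj/= mulr2n.
rewrite (eq_bigr (fun i => if eps i then - e i else e i)); last first.
  by move=> i ij; rewrite flip_off.
by rewrite addrAC addrA addNr add0r.
Qed.

Lemma card_halfcube j :
  (#|[pred eps : {ffun 'I_n -> bool} | eps j]|.*2 = 2 ^ n)%N.
Proof.
have := sum_flip j (fun=> 1%N).
rewrite [LHS]sum1_card card_ffun card_bool card_ord => ->.
by rewrite [RHS](eq_bigr (fun=> 2%N)) // [RHS]sum_nat_const muln2.
Qed.

End flip.

Section update.
Context {n : nat} {I : finType}.
Implicit Types (k : {ffun 'I_n -> I}) (j : 'I_n) (i : I).

Definition upd j k i : {ffun 'I_n -> I} :=
  [ffun l => if l == j then i else k l].

(** Exchanging the [j]-th coordinate of [k] with the free value [i] is an involution on pairs, so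
    each point of the box is reached [#|I|] times. *)
Lemma sum_upd (A : nmodType) j (h : {ffun 'I_n -> I} -> A) :
  \sum_k \sum_i h (upd j k i) = (\sum_k h k) *+ #|I|.
Proof.
pose s (z : {ffun 'I_n -> I} * I) := (upd j z.1 z.2, z.1 j).
have sK : involutive s.
  move=> [k i]; rewrite /s /upd/= ffunE eqxx; congr pair.
  by apply/ffunP => l; rewrite !ffunE; case: eqP => // ->.
rewrite pair_big/= (reindex_inj (inv_inj sK))/=.
rewrite (eq_bigr (fun z => h z.1)); last first.
  move=> z _; congr h; apply/ffunP => l; rewrite !ffunE.
  by case: eqP => // ->.
rewrite -(pair_big xpredT xpredT (fun k (_ : I) => h k))/=.
by rewrite -sumrMnl; apply: eq_bigr => k _; rewrite sumr_const.
Qed.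

End update.

Lemma exists_le_mean (R : realDomainType) (I : finType) (h : I -> R) (c : R) :
  (0 < #|I|)%N -> \sum_i h i <= c *+ #|I| -> exists i, h i <= c.
Proof.
move=> I0 hc; apply/not_existsP => h_gt.
have /card_gt0P[i0 _] := I0.
suff : c *+ #|I| < \sum_i h i by rewrite ltNge hc.
rewrite -sumr_const; apply: ltr_sum.
  by apply/hasP; exists i0; rewrite // mem_index_enum.
by move=> i _; rewrite ltNge; apply/negP/h_gt.
Qed.

(** * A line along which the increments are small *)

Section increment.
Context {R : realType} {X : normedModType R} {V : zmodType}.
Variables (n M : nat) (e : 'I_n -> V) (f : V -> X) (w b : R).
Hypotheses (n_gt0 : (0 < n)%N) (M_gt0 : (0 < M)%N).
Hypothesis f_step : forall y eps, `|f (y + signed_sum e eps) - f y| <= w.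

(* The means over the cube are left unnormalized, whence the factors [2 ^ n]. *)
Let D (j : 'I_n) y := \sum_(eps : {ffun 'I_n -> bool})
  ((-1) ^+ eps j : R) *: (f (y + signed_sum e eps) - f y).

Hypothesis sum_D : forall y, \sum_j `|D j y| <= (2 ^ n)%:R * n%:R * b.

(** Divided by [N j], this is a local average of [f]. Flipping the [j]-th sign translates by
    [e j *+ 2], so [D j] is the increment of [W j] over that step. *)
Let W (j : 'I_n) y :=
  \sum_(eps : {ffun 'I_n -> bool} | eps j) f (y + signed_sum e eps).
Let N (j : 'I_n) := #|[pred eps : {ffun 'I_n -> bool} | eps j]|.

Let D_diff j y : D j y = W j (y + e j *+ 2) - W j y.
Proof.
rewrite /D (sum_flip j) /W -sumrB; apply: eq_bigr => eps epsj.
rewrite flip_diag epsj/= expr0 scale1r expr1 scaleN1r opprB.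
rewrite addrA subrK signed_sum_flip//.
by congr (f _ - _); rewrite addrA addrAC.
Qed.

Let W_close j y : `|W j y - f y *+ N j| <= w *+ N j.
Proof.
rewrite /W /N -!sumr_const -sumrB; apply: le_trans (ler_norm_sum _ _ _) _.
exact: ler_sum.
Qed.

(** The increments [D j] telescope to a difference of two values of [W j], each within [w *+ N j] of
    [f *+ N j]. Dividing by [N j], which is half of [2 ^ n], gives the factor 2 in front of
    [M%:R * b]. *)
Let line_bound j x :
  \sum_(i < M) `|D j (x + e j *+ (i.*2))| <= (2 ^ n)%:R * M%:R * b ->
  `|f (x + e j *+ M.*2) - f x| <= w *+ 2 + M%:R * b *+ 2.
Proof.
move=> xj.
have tele : \sum_(i < M) D j (x + e j *+ i.*2) = W j (x + e j *+ M.*2) - W j x.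
  rewrite -(big_mkord xpredT (fun i => D j (x + e j *+ i.*2))).
  rewrite (eq_bigr (fun i => W j (x + e j *+ i.+1.*2) - W j (x + e j *+ i.*2))).
    by rewrite telescope_sumr// double0 mulr0n addr0.
  by move=> i _; rewrite D_diff -addrA -mulrnDr addn2.
have N_gt0 : 0 < (N j)%:R :> R.
  by rewrite ltr0n -double_gt0 card_halfcube expn_gt0.
rewrite -(ler_pM2r N_gt0) [leLHS]mulr_natr -normrMn mulrnBl.
have -> : f (x + e j *+ M.*2) *+ N j - f x *+ N j =
    \sum_(i < M) D j (x + e j *+ i.*2)
    - (W j (x + e j *+ M.*2) - f (x + e j *+ M.*2) *+ N j)
    + (W j x - f x *+ N j).
  by rewrite tele opprB [X in _ = X + _]addrC !addrA !subrK.
apply: le_trans (ler_normD _ _) _.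
apply: le_trans (lerD (ler_normB _ _) (W_close j x)) _.
have Dj := le_trans (ler_norm_sum _ _ _) xj.
apply: le_trans (lerD (lerD Dj (W_close j _)) (lexx _)) _.
rewrite -(card_halfcube j) -/(N j) -mul2n natrM -(mulr_natr w (N j)).
move: (N j)%:R M%:R => k m.
by rewrite le_eqVlt; apply/orP; left; apply/eqP; ring.
Qed.

Lemma exists_small_increment :
  exists x j, `|f (x + e j *+ M.*2) - f x| <= w *+ 2 + M%:R * b *+ 2.
Proof.
(* The coordinates are doubled because each [D j] accounts for a step of [e j *+ 2]. *)
pose pt (k : {ffun 'I_n -> 'I_M}) := \sum_l e l *+ (k l).*2.
(* The average runs over all directions [j] and all box points [k], with the line through [k] in
   direction [j] as the summand. By [sum_upd] the total is [M] times a sum over the box, to which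
   [sum_D] applies pointwise. *)
have [] := @exists_le_mean _ ('I_n * {ffun 'I_n -> 'I_M})%type
    (fun z => \sum_(i < M) `|D z.1 (pt (upd z.1 z.2 i))|)
    ((2 ^ n)%:R * M%:R * b).
- by rewrite card_prod card_ffun !card_ord muln_gt0 n_gt0 expn_gt0 M_gt0.
- rewrite -(pair_big xpredT xpredT
    (fun j k => \sum_(i < M) `|D j (pt (upd j k i))|))/=.
  under eq_bigr do rewrite (sum_upd _ (fun k => `|D _ (pt k)|)) card_ord.
  rewrite sumrMnl exchange_big/=.
  apply: (@le_trans _ _
      ((\sum_(k : {ffun 'I_n -> 'I_M}) ((2 ^ n)%:R * n%:R * b)) *+ M)).
    by rewrite lerMn2r ler_sum ?orbT// => k _; exact: sum_D.
  rewrite sumr_const card_prod -mulrnA card_ord -[leLHS]mulr_natr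
    -[leRHS]mulr_natr.
  rewrite !natrM; move: (2 ^ n)%:R (#|_|)%:R n%:R M%:R => c1 c2 c3 c4.
  by rewrite le_eqVlt; apply/orP; left; apply/eqP; ring.
(* The line starts at the point whose [j]-th coordinate is 0. *)
- move=> [j k]/= jk; exists (pt (upd j k (Ordinal M_gt0))), j.
  apply: line_bound; apply: le_trans jk; apply: ler_sum => i _.
  suff -> : pt (upd j k i) = pt (upd j k (Ordinal M_gt0)) + e j *+ i.*2 by [].
  rewrite /pt (bigD1 j)//= [in RHS](bigD1 j)//= !ffunE eqxx double0 mulr0n
    add0r.
  rewrite addrC; congr +%R; apply: eq_bigr => l lj.
  by rewrite !ffunE (negPf lj).
Qed.

End increment.

(** * Bessel's inequality for signs and power sums *)

Lemma sign_orthogonal (R : pzRingType) n (i j : 'I_n) :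
  \sum_(eps : {ffun 'I_n -> bool}) (-1) ^+ eps i * (-1) ^+ eps j =
  (2 ^ n)%:R * (i == j)%:R :> R.
Proof.
have [<-|ij] := eqVneq i j; rewrite ?mulr1 ?mulr0.
  under eq_bigr do rewrite -expr2 sqrr_sign.
  by rewrite sumr_const card_ffun card_bool card_ord.
rewrite (sum_flip i) big1// => eps epsi.
by rewrite flip_diag epsi flip_off 1?eq_sym//= expr0 expr1 mul1r mulN1r subrr.
Qed.

(** With [N = 2 ^ n], [P] is [N] times the orthogonal projection of [F] onto the span of the sign
    functions. Expanding the nonnegative sum of [(N * F eps - P eps) ^+ 2] gives the claim. *)
Lemma bessel_signs (R : realDomainType) n (F : {ffun 'I_n -> bool} -> R) :
  \sum_j (\sum_(eps : {ffun 'I_n -> bool}) (-1) ^+ eps j * F eps) ^+ 2 <=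
  (2 ^ n)%:R * \sum_eps F eps ^+ 2.
Proof.
set a := fun j : 'I_n => \sum_(eps : {ffun 'I_n -> bool}) (-1) ^+ eps j * F eps.
rewrite -[X in X <= _]/(\sum_j a j ^+ 2).
set N : R := (2 ^ n)%:R; have N0 : 0 < N by rewrite ltr0n expn_gt0.
pose P (eps : {ffun 'I_n -> bool}) := \sum_j a j * (-1) ^+ eps j.
have FP : \sum_eps F eps * P eps = \sum_j a j ^+ 2.
  under eq_bigr do rewrite mulr_sumr.
  rewrite exchange_big/=; apply: eq_bigr => j _.
  rewrite expr2 [X in _ = _ * X]/a mulr_sumr; apply: eq_bigr => eps _; ring.
have PP : \sum_eps P eps ^+ 2 = N * \sum_j a j ^+ 2.
  have E eps : P eps ^+ 2 =
      \sum_i \sum_j a i * a j * ((-1) ^+ eps i * (-1) ^+ eps j).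
    rewrite expr2 mulr_suml; apply: eq_bigr => i _.
    by rewrite mulr_sumr; apply: eq_bigr => j _; ring.
  under eq_bigr do rewrite E.
  rewrite exchange_big mulr_sumr/=; apply: eq_bigr => i _.
  rewrite exchange_big/= (bigD1 i)//= [X in _ + X]big1 => [|j ji].
    by rewrite -mulr_sumr sign_orthogonal eqxx -/N mulr1 addr0; ring.
  by rewrite -mulr_sumr sign_orthogonal eq_sym (negPf ji) !mulr0.
have : 0 <= \sum_eps (N * F eps - P eps) ^+ 2.
  by apply: sumr_ge0 => eps _; exact: sqr_ge0.
rewrite [X in 0 <= X](_ : _ = N * (N * \sum_eps F eps ^+ 2 - \sum_j a j ^+ 2)).
  by rewrite pmulr_rge0// subr_ge0.
transitivity (N ^+ 2 * (\sum_eps F eps ^+ 2)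
    - 2 * N * (\sum_eps F eps * P eps) + \sum_eps P eps ^+ 2).
  rewrite !mulr_sumr -sumrB -big_split/=.
  by apply: eq_bigr => eps _; ring.
by rewrite FP PP; ring.
Qed.

Section power_sums.
Context {R : realType} {I : finType}.
Variables (x : I -> R) (r : R).
Hypotheses (x0 : forall i, 0 <= x i) (r1 : 1 <= r).

Let S0 : 0 <= \sum_i x i. Proof. exact: sumr_ge0. Qed.
Let r0 : 0 < r. Proof. exact: lt_le_trans r1. Qed.

(** Write $x_i^r = x_i x_i^{r-1}$ and bound the second factor by $S^{r-1}$, where $S$ is the whole
    sum. *)
Lemma sum_powR_le : \sum_i x i `^ r <= (\sum_i x i) `^ r.
Proof.
rewrite -(mulr_powRB1 S0 r0) mulr_suml; apply: ler_sum => i _.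
rewrite -(mulr_powRB1 (x0 i) r0) ler_wpM2l// ge0_ler_powR ?nnegrE ?subr_ge0//.
by rewrite (bigD1 i)//= lerDl sumr_ge0.
Qed.

(** Young's inequality for $N x_i$ and $S^{r-1}$, with exponents $r$ and $r/(r-1)$, is summed over
    $i$; the terms in $N S^r$ are then collected. *)
Lemma power_mean : (\sum_i x i) `^ r <= #|I|%:R `^ (r - 1) * \sum_i x i `^ r.
Proof.
have [/eqP I0|I0] := posnP #|I|.
  rewrite !big_pred0 ?mulr0 ?powR0 ?gt_eqF// => i;
  by move: I0; rewrite -(negbK (_ == _)) -lt0n => /card_gt0P; case; exists i.
(* The case $r = 1$ is separate, since the conjugate exponent $r/(r-1)$ requires $r > 1$. *)
move: r1; rewrite le_eqVlt => /predU1P[<-|r_gt1].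
  rewrite subrr powRr0 mul1r powRr1//.
  by under [leRHS]eq_bigr do rewrite powRr1//.
set S := \sum_i x i; set N : R := #|I|%:R.
have N0 : 0 < N by rewrite ltr0n.
have r'0 : 0 < r / (r - 1) by rewrite divr_gt0// subr_gt0.
have young i : N * x i * S `^ (r - 1) <=
    (N * x i) `^ r / r + S `^ r * (1 - r^-1).
  have r'E : (r / (r - 1))^-1 = 1 - r^-1.
    by rewrite invf_div; field; rewrite gt_eqF.
  have rr' : r^-1 + (r / (r - 1))^-1 = 1 by rewrite r'E addrC subrK.
  have := @conjugate_powR R (N * x i) (S `^ (r - 1)) _ _
    (mulr_ge0 (ltW N0) (x0 i)) (powR_ge0 _ _) r0 r'0 rr'.
  by rewrite r'E -powRrM (mulrC (r - 1)) divfK// subr_eq0 gt_eqF.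
have : N * S `^ r <= (\sum_i (N * x i) `^ r) / r + N * S `^ r * (1 - r^-1).
  have -> : N * S `^ r * (1 - r^-1) = \sum_(i : I) S `^ r * (1 - r^-1).
    by rewrite sumr_const -mulr_natl mulrA.
  rewrite mulr_suml -big_split/=.
  rewrite -[in leLHS](mulr_powRB1 S0 r0) mulrA mulr_sumr mulr_suml.
  by apply: ler_sum => i _; exact: young.
under eq_bigr do rewrite powRM ?(ltW N0)//.
rewrite -mulr_sumr -(mulr_powRB1 (ltW N0) r0) => h.
rewrite -(ler_pM2l N0) mulrA -(@ler_pM2r _ r^-1) ?invr_gt0//.
lra.
Qed.

End power_sums.

(** Since $q/2 \ge 1$, [sum_powR_le] passes from squares to $q$-th powers on the left of Bessel's
    inequality, and [power_mean] over the cube does so on the right. *)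
Lemma signs_powR (R : realType) (q : R) n (F : {ffun 'I_n -> bool} -> R) :
  2 <= q ->
  \sum_j `|\sum_(eps : {ffun 'I_n -> bool}) (-1) ^+ eps j * F eps| `^ q <=
  (2 ^ n)%:R `^ (q - 1) * \sum_eps `|F eps| `^ q.
Proof.
move=> q2.
have normE (x : R) : `|x| `^ q = (x ^+ 2) `^ (q / 2).
  rewrite -real_normK ?num_real// -powR_mulrn// -powRrM.
  by congr powR; field.
have q21 : 1 <= q / 2 by lra.
under eq_bigr do rewrite normE.
apply: le_trans (sum_powR_le _ q21) _ => [j|]; first exact: sqr_ge0.
apply: le_trans (ge0_ler_powR _ _ _ (bessel_signs F)) _.
- by rewrite (le_trans ler01).
- by rewrite nnegrE sumr_ge0// => j _; exact: sqr_ge0.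
- by rewrite nnegrE mulr_ge0// sumr_ge0// => j _; exact: sqr_ge0.
rewrite powRM//; last by rewrite sumr_ge0// => j _; exact: sqr_ge0.
(* The exponent $q/2$ comes from the factor [2 ^ n] in Bessel's inequality, and $q/2 - 1$ from the
   power mean. *)
have -> : q - 1 = q / 2 + (q / 2 - 1) by field.
rewrite powRD; last by rewrite pnatr_eq0 expn_eq0 implybT.
rewrite -mulrA ler_wpM2l ?powR_ge0//.
under [in leRHS]eq_bigr do rewrite normE.
have := power_mean (fun eps => sqr_ge0 (F eps)) q21.
by rewrite card_ffun card_bool card_ord.
Qed.

(** * Passing from scalars to $L_q$ by integration *)

Section Lspace_sums.
Context d (T : measurableType d) (R : realType).
Variables (mu : {measure set T -> \bar R}) (p : \bar R) (p1 : (1 <= p)%E).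
Notation Lf := (LfunType mu p1).
Notation Ls := (LspaceType mu p1).

Lemma Lclass_lincomb (I : finType) (c : I -> R) (g : I -> Lf) :
  \sum_i c i *: Lclass (g i) = Lclass (\sum_i c i *: g i) :> Ls.
Proof.
elim/big_ind2 : _ => // [f1 f2 g1 g2 -> ->|i _].
  exact: Lclass_add.
exact: Lclass_scale.
Qed.

Lemma Lfun_lincomb (I : finType) (c : I -> R) (g : I -> Lf) x :
  (\sum_i c i *: g i : Lf) x = \sum_i c i * g i x.
Proof. by elim/big_ind2 : _ => // f1 f2 g1 g2 <- <-. Qed.

End Lspace_sums.

Lemma normr_Lclass d (T : measurableType d) (R : realType)
    (mu : {measure set T -> \bar R}) (p : \bar R) (p1 : (1 <= p)%E)
    (f : LfunType mu p1) :
  `|Lclass f : LspaceType mu p1| = fine ('N[mu]_p[EFin \o f])%E.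
Proof. exact: Lclass_norm. Qed.

Lemma powR_norm_Lclass d (T : measurableType d) (R : realType)
    (mu : {measure set T -> \bar R}) (p : R) (p1 : (1 <= p%:E)%E)
    (f : LfunType mu p1) :
  ((`|Lclass f : LspaceType mu p1| `^ p)%:E =
   \int[mu]_x (`|f x| `^ p)%:E)%E.
Proof.
have p0 : p != 0 by rewrite gt_eqF// (lt_le_trans ltr01)// -lee_fin.
rewrite -poweR_EFin normr_Lclass finite_norm_fine poweR_Lnorm//.
Qed.

Lemma measurable_norm_powR d (T : measurableType d) (R : realType) (p : R)
    (f : T -> R) : measurable_fun [set: T] f ->
  measurable_fun [set: T] (fun x => (`|f x| `^ p)%:E).
Proof.
move=> mf; apply/measurable_EFinP/(measurableT_comp (measurable_powR _)) => //.
exact: measurableT_comp.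
Qed.

(** Both sides are integrals of $q$-th powers of representatives, so [signs_powR] at each point
    suffices. *)
Lemma signs_Lspace d (T : measurableType d) (R : realType)
    (nu : {measure set T -> \bar R}) (q : R) (q1 : (1 <= q%:E)%E) n
    (F : {ffun 'I_n -> bool} -> LspaceType nu q1) :
  2 <= q ->
  \sum_j
    `|\sum_(eps : {ffun 'I_n -> bool}) ((-1) ^+ eps j : R) *: F eps| `^ q <=
  (2 ^ n)%:R `^ (q - 1) * \sum_eps `|F eps| `^ q.
Proof.
move=> q2; pose g eps := Lrepr (F eps).
have gF eps : F eps = Lclass (g eps) by rewrite LreprK.
under [in leRHS]eq_bigr do rewrite gF.
have FE (j : 'I_n) :
    \sum_(eps : {ffun 'I_n -> bool}) ((-1) ^+ eps j : R) *: F eps =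
    Lclass (\sum_(eps : {ffun 'I_n -> bool}) ((-1) ^+ eps j : R) *: g eps).
  by rewrite -Lclass_lincomb; apply: eq_bigr => eps _; rewrite gF.
under [in leLHS]eq_bigr do rewrite FE.
have mL (h : LfunType nu q1) :
    measurable_fun [set: T] (fun x => (`|h x| `^ q)%:E).
  exact/measurable_norm_powR/(measurable_funPT (h : {mfun T >-> R})).
rewrite -lee_fin EFinM -!sumEFin.
under [in leLHS]eq_bigr do rewrite powR_norm_Lclass.
under [in leRHS]eq_bigr do rewrite powR_norm_Lclass.
have pos (h : LfunType nu q1) x : (0 <= (`|h x| `^ q)%:E)%E.
  by rewrite lee_fin powR_ge0.
rewrite -!ge0_integral_sum//.
rewrite -ge0_integralZl//; last 2 first.
- by apply: emeasurable_sum => eps; exact: mL.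
- by move=> ? ?; exact: sume_ge0.
apply: ge0_le_integral => //.
- by move=> x _; exact: sume_ge0.
- by apply: emeasurable_sum => j; exact: mL.
- by apply: measurable_funeM; apply: emeasurable_sum => eps; exact: mL.
move=> x _; rewrite !sumEFin -EFinM lee_fin.
under [in leLHS]eq_bigr do rewrite Lfun_lincomb.
exact: signs_powR.
Qed.

(** * Atoms and disjoint sets of positive finite measure *)

Section disjoint_sets.
Context d (T : measurableType d) (R : realType).
Variable mu : {measure set T -> \bar R}.

(** On an atom one of [L r] and [U r] is negligible for each level [r]. The constant is the level
    where the negligible one switches from [L r] to [U r]. *)
Lemma atom_ae_cst (A : set T) (f : T -> R) :
  measurable A -> ~ mu.-negligible A -> measurable_fun [set: T] f ->
  (forall B, measurable B -> B `<=` A ->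
    mu.-negligible B \/ mu.-negligible (A `\` B)) ->
  exists c, mu.-negligible (A `&` [set x : T | f x != c]).
Proof.
move=> mA A0 mf atomA.
pose L r := A `&` [set x | f x <= r].
pose U r := A `&` [set x | r < f x].
have L_or_U r : mu.-negligible (L r) \/ mu.-negligible (U r).
  have mL : measurable (L r).
    apply: measurableI => //.
    rewrite [X in measurable X](_ : _ = [set: T] `&` f @^-1` `]-oo, r]).
      exact: mf.
    by rewrite setTI; apply/seteqP; split => x /=; rewrite in_itv.
  case: (atomA _ mL (@subIsetl _ _ _)) => H; [by left|right].
  apply: negligibleS H => x [Ax /= fx]; split => // -[_ /=].
  by rewrite leNgt fx.
pose S := [set r | mu.-negligible (L r)].
have U_notS r : ~ S r -> mu.-negligible (U r) by case: (L_or_U r).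
(* Otherwise every [U (- k%:R)] would be negligible, and these sets exhaust [A]. Dually, the sets
   [L k%:R] show that [S] is not everything. *)
have [s0 Ss0] : S !=set0.
  apply/set0P/eqP => S0; apply: A0.
  apply: (@negligibleS _ _ _ _ (\bigcup_k U (- k%:R))); last first.
    apply: negligible_bigcup => k; apply: U_notS.
    by rewrite -/(S _) S0.
  move=> x Ax; exists (Num.bound `|f x|) => //; split => //=.
  rewrite ltrNl (le_lt_trans (ler_norm _))// normrN.
  by rewrite archi_boundP.
have [r0 Sr0] : exists r, ~ S r.
  apply/existsNP => ST; apply: A0.
  apply: (@negligibleS _ _ _ _ (\bigcup_k L k%:R)); last first.
    by apply: negligible_bigcup => k; exact: ST.
  move=> x Ax; exists (Num.bound `|f x|) => //; split => //=.
  by rewrite (le_trans (ler_norm _))// ltW// archi_boundP.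
have S_down r s : S s -> r <= s -> S r.
  move=> Ss rs; apply: negligibleS Ss => x [Ax /= fx].
  by split => //=; exact: le_trans rs.
have supS : has_sup S.
  split; first by exists s0.
  exists r0 => r Sr; rewrite leNgt; apply/negP => /ltW r0r.
  exact/Sr0/(S_down _ _ Sr).
exists (sup S).
apply: (@negligibleS _ _ _ _ (\bigcup_k L (sup S - k.+1%:R^-1) `|`
    \bigcup_k U (sup S + k.+1%:R^-1))).
  move=> x [Ax /=]; rewrite neq_lt => /orP[|] /ltr_add_invr[k fk].
    by left; exists k => //; split => //=; rewrite lerBrDr ltW.
  by right; exists k.
apply: negligibleU; apply: negligible_bigcup => k.
  have k0 : 0 < k.+1%:R^-1 :> R by rewrite invr_gt0.
  have [r Sr r_gt] := sup_adherent k0 supS.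
  exact: (S_down _ _ Sr (ltW r_gt)).
apply: U_notS => /(ub_le_sup supS.2).
by rewrite leNgt ltrDl invr_gt0 ltr0n.
Qed.

Definition disjoint_sets (k : nat) : Prop :=
  exists A : nat -> set T,
    (forall i, (i < k)%N -> measurable (A i) /\ (0 < mu (A i) < +oo)%E) /\
    (forall i j, (i < k)%N -> (j < k)%N -> i != j -> A i `&` A j = set0).

Lemma disjoint_setsS k (A : nat -> set T) (C : set T) :
  (forall i, (i < k)%N -> measurable (A i) /\ (0 < mu (A i) < +oo)%E) ->
  (forall i j, (i < k)%N -> (j < k)%N -> i != j -> A i `&` A j = set0) ->
  measurable C -> (0 < mu C < +oo)%E ->
  (forall i, (i < k)%N -> A i `&` C = set0) ->
  disjoint_sets k.+1.
Proof.
move=> hA dA mC C0 dC; exists (fun i => if i == k then C else A i).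
split=> [i|i j]; rewrite !ltnS leq_eqVlt.
  by case: eqP => //= _ ik; exact: hA.
rewrite [(j <= k)%N]leq_eqVlt; case: (eqVneq i k) => [->|_];
  case: (eqVneq j k) => [->|_] /=.
- by [].
- by move=> _ jk _; rewrite setIC; exact: dC.
- by move=> ik _ _; exact: dC.
- exact: dA.
Qed.

(** If both pieces had positive measure, replacing [A i] by [B] and adjoining the difference would
    produce [k.+1] disjoint sets. *)
Lemma disjoint_sets_max_atom k (A : nat -> set T) i (B : set T) :
  (forall i, (i < k)%N -> measurable (A i) /\ (0 < mu (A i) < +oo)%E) ->
  (forall i j, (i < k)%N -> (j < k)%N -> i != j -> A i `&` A j = set0) ->
  ~ disjoint_sets k.+1 -> (i < k)%N -> measurable B -> B `<=` A i ->
  mu.-negligible B \/ mu.-negligible (A i `\` B).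
Proof.
move=> hA dA maxk ik mB BA; have [mAi /andP[_ Aioo]] := hA _ ik.
have mD : measurable (A i `\` B) by exact: measurableD.
rewrite !negligibleP//; apply: contrapT => /not_orP[/eqP B0 /eqP D0].
apply/maxk/(@disjoint_setsS k (fun j => if j == i then B else A j) (A i `\` B));
  rewrite //.
- move=> j jk; case: eqVneq => _; last exact: hA.
  split=> //; rewrite lt0e B0 measure_ge0/=.
  by apply: le_lt_trans Aioo; apply: le_measure => //; rewrite inE.
- move=> j l jk lk jl; have [ji|ji] := eqVneq j i; have [li|li] := eqVneq l i.
  + by rewrite ji li eqxx in jl.
  + by rewrite -subset0 -(dA i l)// 1?eq_sym//; exact: setSI.
  + by rewrite -subset0 -(dA j i)//; exact: setIS.
  + exact: dA.
- rewrite lt0e D0 measure_ge0/=.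
  by apply: le_lt_trans Aioo; apply: le_measure => //; rewrite ?inE.
- move=> j jk; case: eqVneq => [_|ji].
    by rewrite setDE setICA setICr setI0.
  by rewrite -subset0 -(dA j i)//; apply: setIS; exact: subDsetl.
Qed.

End disjoint_sets.

(** * Disjointly supported unit vectors in $L_p$ *)

Section disjoint_Lfun.
Context d (T : measurableType d) (R : realType).
Variables (mu : {measure set T -> \bar R}) (p : R) (p1 : (1 <= p%:E)%E).
Notation Lf := (LfunType mu p1).
Notation Ls := (LspaceType mu p1).

Let p0 : 0 < p. Proof. by rewrite -lte_fin; apply: lt_le_trans p1. Qed.

Lemma indic_powR (A : set T) x : `|\1_A x : R| `^ p = \1_A x.
Proof.
rewrite indicE; case: (_ \in _); rewrite ?normr1 ?powR1// normr0 powR0//.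
by rewrite gt_eqF.
Qed.

Lemma indic_Lfun (A : set T) : measurable A -> (mu A < +oo)%E ->
  (\1_A : T -> R) \in Lfun mu p%:E.
Proof.
move=> mA Aoo; apply/andP; split; rewrite inE/=.
  exact: measurable_indic.
rewrite /finite_norm unlock poweR_lty//.
under eq_integral do rewrite /= indic_powR.
by rewrite integral_indic// setIT.
Qed.

(** Markov's inequality for $|f|^p$. *)
Lemma Lfun_level_finite (f : Lf) (a : R) : 0 < a ->
  (mu [set x : T | (a <= `|f x|)%R] < +oo)%E.
Proof.
move=> a0.
have mf : measurable_fun [set: T] f.
  exact: (measurable_funPT (f : {mfun T >-> R})).
have hnd : {in `[0%E, +oo[%classic &,
    {homo (fun e : \bar R => e `^ p)%E : x y / (x <= y)%E}}.
  move=> x y; rewrite !inE/= !in_itv/= !andbT => x0 y0.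
  by apply: gt0_ler_poweR; rewrite ?(ltW p0)// in_itv/= ?x0 ?y0 ?leey.
have := @le_integral_comp_abse _ _ _ mu _ measurableT (EFin \o f) a
  (fun e => e `^ p)%E (measurable_poweR p) (fun r _ => poweR_ge0 r p) hnd
  (proj2 (measurable_EFinP _ _) mf) a0.
rewrite setTI /= => h.
have : ((a `^ p)%:E * mu [set x : T | (a <= `|f x|)%R] <=
    (`|Lclass f : Ls| `^ p)%:E)%E.
  by rewrite powR_norm_Lclass.
have ap : 0 < a `^ p by rewrite powR_gt0.
move=> /le_lt_trans/(_ (ltry _)); rewrite ltNge => /negP mu_oo.
rewrite ltey; apply/eqP => muE; apply: mu_oo.
by rewrite muE gt0_muley ?lte_fin// leey.
Qed.

(* If [k] is the maximal number of disjoint sets of positive finite measure,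
   each [A i] is an atom, so the indicators of the [A i] span [L_p]. *)
Lemma disjoint_sets_of_infinite_dim n :
  infinite_dimensional Ls -> disjoint_sets mu n.
Proof.
move=> infLs; elim: n => [|k IH]; first by exists (fun=> set0).
apply: contrapT => maxk; apply: infLs; case: IH => A [hA dA].
have mA i : (i < k)%N -> measurable (A i) by move=> /hA[].
have Aoo i : (i < k)%N -> (mu (A i) < +oo)%E by move=> /hA[_ /andP[]].
pose u (i : 'I_k) : Lf :=
  Lfun_Sub p1 (indic_Lfun (mA _ (ltn_ord i)) (Aoo _ (ltn_ord i))).
exists k, (fun i => Lclass (u i)) => F.
set f := Lrepr F.
have mf : measurable_fun [set: T] f.
  exact: (measurable_funPT (f : {mfun T >-> R})).
have /choice[c hc] (i : 'I_k) :
    exists c, mu.-negligible (A i `&` [set x : T | f x != c]).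
  have [mAi /andP[Ai0 _]] := hA _ (ltn_ord i).
  apply: atom_ae_cst => //.
    by rewrite negligibleP// => Ai; rewrite Ai ltxx in Ai0.
  by move=> B mB BA; exact: (disjoint_sets_max_atom hA).
exists c; rewrite -[F]LreprK -/f Lclass_lincomb; apply: eq_Lclass.
pose O := ~` \bigcup_(i in [set i | (i < k)%N]) A i.
have mO : measurable O.
  apply/measurableC/bigcup_measurable => i /=; exact: mA.
(* Such a level set has finite measure and misses every [A i]; were its measure positive, it would
   be one more disjoint set. Hence [f] vanishes almost everywhere on [O]. *)
have O0 m : mu.-negligible (O `&` [set x : T | m.+1%:R^-1 <= `|f x|]).
  have ml : measurable [set x : T | m.+1%:R^-1 <= `|f x|].
    have mnf : measurable_fun [set: T] (fun x => `|f x|).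
      exact: measurableT_comp.
    rewrite [X in measurable X](_ : _ =
        [set: T] `&` (fun x => `|f x|) @^-1` `[m.+1%:R^-1, +oo[).
      exact: mnf.
    by rewrite setTI; apply/seteqP; split => x /=; rewrite in_itv/= andbT.
  have mOm := measurableI _ _ mO ml.
  rewrite negligibleP//; apply: contrapT => /eqP Om; apply: maxk.
  apply: (disjoint_setsS hA dA mOm).
    rewrite lt0e Om measure_ge0/=.
    have m0 : 0 < m.+1%:R^-1 :> R by rewrite invr_gt0.
    apply: le_lt_trans (Lfun_level_finite f m0).
    by apply: le_measure; rewrite ?inE.
  move=> i ik; rewrite setIA [X in X `&` _](_ : _ = set0) ?set0I//.
  by rewrite -subset0 => x [Ax]; apply; exists i.
pose bad := \bigcup_m (O `&` [set x : T | m.+1%:R^-1 <= `|f x|]) `|`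
  \big[setU/set0]_(i < k) (A i `&` [set x : T | f x != c i]).
suff bad0 : mu.-negligible bad.
  apply: negligibleS bad0 => x /=; apply: contra_notP.
  rewrite /bad => /not_orP[xO xA] _.
  rewrite Lfun_lincomb.
  have [[i /= ik Aix]|Ox] := pselect (exists2 i, (i < k)%N & A i x).
    rewrite (bigD1 (Ordinal ik))//= big1 ?addr0 => [|j ji].
      rewrite indicE mem_set// mulr1; apply/eqP/negPn/negP => fx.
      by apply: xA; rewrite (bigD1 (Ordinal ik))//=; left.
    rewrite indicE memNset ?mulr0// => Ajx.
    suff : (A j `&` A i) x by rewrite (dA j i).
    by [].
  rewrite big1 => [|j _].
    apply/eqP; apply: contra_notT xO => fx.
    have /ltr_add_invr[m] : 0 < `|f x| by rewrite normr_gt0.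
    by rewrite add0r => /ltW fxm; exists m.
  rewrite /= indicE memNset ?mulr0// => Ajx.
  by apply: Ox; exists j.
apply: negligibleU; first exact: negligible_bigcup.
by elim/big_ind : _ => //; [exact: negligible_set0|exact: negligibleU].
Qed.

Lemma disjoint_unit_Lfun n : infinite_dimensional Ls ->
  exists u : 'I_n -> Lf, (forall i, `|Lclass (u i) : Ls| = 1) /\
    (forall x i j, i != j -> u i x * u j x = 0).
Proof.
move=> /(@disjoint_sets_of_infinite_dim n)[A [hA dA]].
have mA i : (i < n)%N -> measurable (A i) by move=> /hA[].
have Aoo i : (i < n)%N -> (mu (A i) < +oo)%E by move=> /hA[_ /andP[]].
pose v (i : 'I_n) : Lf :=
  Lfun_Sub p1 (indic_Lfun (mA _ (ltn_ord i)) (Aoo _ (ltn_ord i))).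
exists (fun i => `|Lclass (v i) : Ls|^-1 *: v i); split => [i|x i j ij].
  rewrite -Lclass_scale -[Lspace_scale _ _]/((_ : R) *: (_ : Ls)).
  rewrite normrZ normfV normr_id mulVf//.
  (* The norm is nonzero because its $p$-th power is [mu (A i)]. *)
  apply/eqP => vi0; have := powR_norm_Lclass (v i).
  rewrite vi0 powR0 ?gt_eqF//.
  under eq_integral do rewrite /= indic_powR.
  have [mAi /andP[Ai0 _]] := hA _ (ltn_ord i).
  rewrite integral_indic//.
  by rewrite setIT => Ai; rewrite -Ai ltxx in Ai0.
rewrite -[LHS]/((_ * \1_(A i) x) * (_ * \1_(A j) x)) mulrACA.
rewrite [X in _ * X](_ : _ = \1_(A i `&` A j) x); last by rewrite indicI.
by rewrite dA// indic0 mulr0.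
Qed.

(** At each point at most one [u i] is nonzero, so the $p$-th powers add up and the signs
    disappear. *)
Lemma norm_signed_sum n (u : 'I_n -> Lf) eps :
  (forall i, `|Lclass (u i) : Ls| = 1) ->
  (forall x i j, i != j -> u i x * u j x = 0) ->
  `|signed_sum (fun i => Lclass (u i) : Ls) eps| = n%:R `^ p^-1.
Proof.
move=> u1 ud.
have -> : signed_sum (fun i => Lclass (u i) : Ls) eps =
    Lclass (\sum_i ((-1) ^+ eps i : R) *: u i).
  rewrite -Lclass_lincomb; apply: eq_bigr => i _.
  by case: (eps i); rewrite ?expr1 ?scaleN1r ?expr0 ?scale1r.
have powRpV (x : R) : 0 <= x -> x = (x `^ p) `^ p^-1.
  by move=> x0; rewrite -powRrM mulfV ?gt_eqF// powRr1.
rewrite [LHS]powRpV//; congr (_ `^ _).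
apply/EFin_inj; rewrite powR_norm_Lclass.
have mu_powR i : measurable_fun [set: T] (fun x => (`|u i x| `^ p)%:E).
  exact/measurable_norm_powR/(measurable_funPT (u i : {mfun T >-> R})).
transitivity (\int[mu]_x \sum_i (`|u i x| `^ p)%:E)%E.
  apply: eq_integral => x _; rewrite sumEFin Lfun_lincomb; congr EFin.
  have [/existsP[i ui]|] := boolP [exists i, u i x != 0].
    have u0 j : j != i -> u j x = 0.
      move=> ji; apply/eqP; move/eqP: (ud x _ _ ji).
      by rewrite mulf_eq0 (negPf ui) orbF.
    rewrite (bigD1 i)//= [in RHS](bigD1 i)//= !big1 ?addr0 =>
      [|j /u0 ->|j /u0 ->].
    - by rewrite normrM normr_sign mul1r.
    - by rewrite normr0 powR0// gt_eqF.
    - by rewrite mulr0.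
  rewrite negb_exists => /forallP u0.
  rewrite !big1 ?normr0 ?powR0 ?gt_eqF// => i _; have /eqP -> := negPn (u0 i).
    by rewrite normr0 powR0// gt_eqF.
  by rewrite mulr0.
rewrite ge0_integral_sum//.
under eq_bigr do rewrite -powR_norm_Lclass u1 powR1.
by rewrite sumEFin sumr_const card_ord.
Qed.

End disjoint_Lfun.

(** * Choice of parameters and conclusion *)

Lemma natpowR_ge (R : realType) (r C : R) : 0 < r ->
  exists2 n, (0 < n)%N & C <= n%:R `^ r.
Proof.
move=> r0; exists (Num.truncn (`|C| `^ r^-1)).+1 => //.
rewrite (le_trans (ler_norm C))//.
rewrite -[leLHS]powRr1// -{1}(mulVf (lt0r_neq0 r0)) powRrM.
apply: ge0_ler_powR; rewrite ?nnegrE ?powR_ge0 ?(ltW r0)//.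
exact/ltW/truncnS_gt.
Qed.

Lemma mdist_Lspace d (T : measurableType d) (R : realType)
    (mu : {measure set T -> \bar R}) (p : \bar R) (p1 : (1 <= p)%E)
    (f g : LspaceType mu p1) : mdist f g = `|f - g|.
Proof. by []. Qed.

(** This provides the hypothesis [sum_D] with $b = w / n^{1/q}$. After raising to the power $q$, the
    power mean over the $n$ directions is followed by [signs_Lspace]. *)
Lemma sum_norm_signs_Lspace d (T : measurableType d) (R : realType)
    (nu : {measure set T -> \bar R}) (q : R) (q1 : (1 <= q%:E)%E) n (w : R)
    (F : {ffun 'I_n -> bool} -> LspaceType nu q1) :
  2 <= q -> (0 < n)%N -> (forall eps, `|F eps| <= w) ->
  \sum_j `|\sum_(eps : {ffun 'I_n -> bool}) ((-1) ^+ eps j : R) *: F eps| <=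
  (2 ^ n)%:R * n%:R * (w / n%:R `^ q^-1).
Proof.
move=> q2 n_gt0 Fw.
have q0 : 0 < q by lra.
have q1' : 1 <= q by lra.
have w0 : 0 <= w by apply: le_trans (Fw [ffun=> false]).
set N : R := (2 ^ n)%:R; have N0 : 0 <= N by rewrite ler0n.
have n0 : 0 < n%:R :> R by rewrite ltr0n.
rewrite leNgt; apply/negP => /(gt0_ltr_powR q0).
rewrite !nnegrE sumr_ge0// ?mulr_ge0 ?invr_ge0 ?powR_ge0 ?ler0n// =>
  /(_ isT isT).
apply/negP; rewrite -leNgt.
apply: le_trans (power_mean _ q1') _ => //.
apply: le_trans (ler_wpM2l (powR_ge0 _ _) (signs_Lspace F q2)) _.
rewrite card_ord -/N.
have -> : (N * n%:R * (w / n%:R `^ q^-1)) `^ q =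
    n%:R `^ (q - 1) * (N `^ (q - 1) * (N * w `^ q)).
  rewrite !powRM ?mulr_ge0 ?invr_ge0 ?powR_ge0// ?(ltW n0)//.
  rewrite -powRN -powRrM mulNr mulVf ?gt_eqF// powR_inv1 ?ler0n//.
  rewrite -(mulr_powRB1 N0 q0) -(mulr_powRB1 (ltW n0) q0).
  by field; rewrite gt_eqF.
rewrite ler_wpM2l ?powR_ge0// ler_wpM2l ?powR_ge0//.
apply: (@le_trans _ _ (\sum_(eps : {ffun 'I_n -> bool}) w `^ q)).
  by apply: ler_sum => eps _; rewrite ge0_ler_powR ?nnegrE// ltW.
by rewrite sumr_const card_ffun card_bool card_ord -mulr_natl.
Qed.

Lemma exists_far_pair_close_images (R : realType) (p q : R) (p1 : (1 <= p%:E)%E)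
    (q1 : (1 <= q%:E)%E) (d1 : measure_display) (T1 : measurableType d1)
    (mu : {measure set T1 -> \bar R}) (d2 : measure_display)
    (T2 : measurableType d2) (nu : {measure set T2 -> \bar R})
    (phi : LspaceType mu p1 -> LspaceType nu q1) (w delta t : R) :
  2 <= q -> q < p -> infinite_dimensional (LspaceType mu p1) ->
  0 < delta ->
  (forall x y, mdist x y <= delta -> mdist (phi x) (phi y) <= w) ->
  exists x y, t <= mdist x y /\ mdist (phi x) (phi y) <= w *+ 4.
Proof.
move=> q2 qp infLp delta0 phiw.
have q0 : 0 < q by lra.
have p0 : 0 < p by lra.
have w0 : 0 <= w.
  by apply: le_trans (phiw 0 0 _); rewrite ?mdist_Lspace ?subrr ?normr0// ltW.
have r0 : 0 < q^-1 - p^-1 by rewrite subr_gt0 ltf_pV2.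
(* The dimension [n] is such that $\delta n^{1/q - 1/p} \ge t$. *)
have [n n_gt0 tn] := natpowR_ge (t / delta) r0.
have n0 : 0 < n%:R :> R by rewrite ltr0n.
have [u [u1 ud]] := disjoint_unit_Lfun n infLp.
(* As $M \le n^{1/q}$, the term [M%:R * b] stays below [w]; as $2M \ge n^{1/q}$, the end points of
   the line are far apart. *)
pose M := Num.truncn (n%:R `^ q^-1 : R).
have nq1 : 1 <= n%:R `^ q^-1 :> R.
  by rewrite -[leLHS](powRr0 n%:R) ler_powR ?invr_ge0 ?(ltW q0)// ler1n.
have M_gt0 : (0 < M)%N by rewrite truncn_gt0.
have M_le : M%:R <= n%:R `^ q^-1 :> R by rewrite truncn_le// powR_ge0.
have M_ge : n%:R `^ q^-1 <= M.*2%:R :> R.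
  apply: (@le_trans _ _ M.+1%:R); first exact/ltW/truncnS_gt.
  by rewrite ler_nat -addnn -addn1 leq_add2l.
(* By [norm_signed_sum], this scaling gives every signed sum of the [e i] norm exactly [delta]. *)
pose c := delta / n%:R `^ p^-1.
have np0 : 0 < n%:R `^ p^-1 :> R by rewrite powR_gt0.
have c0 : 0 < c by rewrite divr_gt0.
pose e i : LspaceType mu p1 := c *: Lclass (u i).
have norm_step eps : `|signed_sum e eps| = delta.
  have -> : signed_sum e eps =
      c *: signed_sum (fun i => Lclass (u i) : LspaceType mu p1) eps.
    rewrite /signed_sum scaler_sumr; apply: eq_bigr => i _.
    by case: (eps i); rewrite ?scalerN.
  by rewrite normrZ norm_signed_sum// gtr0_norm// /c divfK// gt_eqF.
have step y eps : `|phi (y + signed_sum e eps) - phi y| <= w.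
  by rewrite -mdist_Lspace phiw// mdist_Lspace addrAC subrr add0r norm_step.
have [y|x [j xj]] := @exists_small_increment _ _ _ n M e phi w
  (w / n%:R `^ q^-1) n_gt0 M_gt0 step.
  exact: (sum_norm_signs_Lspace q2 n_gt0 (step y)).
exists (x + e j *+ M.*2), x; split.
  rewrite mdist_Lspace addrAC subrr add0r normrMn normrZ u1 mulr1 gtr0_norm//.
  rewrite -mulr_natr /c mulrAC ler_pdivlMr//.
  rewrite -ler_pdivrMl// mulrC mulrAC -ler_pdivlMr//.
  apply: le_trans tn _; rewrite powRB; last by rewrite (gt_eqF n0) implybT.
  by rewrite ler_pM2r ?invr_gt0.
rewrite mdist_Lspace; apply: le_trans xj _.
have : M%:R * (w / n%:R `^ q^-1) <= w.
  rewrite mulrCA ler_piMr// ler_pdivrMr ?mul1r//.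
  exact: lt_le_trans nq1.
by lra.
Qed.

Theorem proposition5p11 (R : realType) (p q : R) (hq : 2 <= q) (hqp : q < p)
    (d1 : measure_display) (T1 : measurableType d1)
    (mu : {measure set T1 -> \bar R})
    (d2 : measure_display) (T2 : measurableType d2)
    (nu : {measure set T2 -> \bar R}) :
  let Lp := LspaceType mu (le2_lee1 (le_trans hq (ltW hqp))) in
  let Lq := LspaceType nu (le2_lee1 hq) in
  infinite_dimensional Lp -> infinite_dimensional Lq ->
  (CR Lp Lq <= 30%:E)%E.
Proof.
move=> Lp Lq infLp _; apply: ge_ereal_sup => _ [phi _ <-].
have omega0 : (0 <= omega phi)%E.
  apply: le_ereal_inf_tmp => _ [t /= t0 <-]; apply: ereal_sup_ge.
  exists (mdist (phi 0) (phi 0))%:E; last by rewrite lee_fin mdist_ge0.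
  by exists (0, 0) => //=; rewrite mdistxx ltW.
(* Any [w] above [omega phi] bounds [omega_fun phi delta] for some [delta]; the far pair is then
   available for every [t]. *)
have kappa_le w : (omega phi < w%:E)%E -> (kappa phi <= (w *+ 4)%:E)%E.
  move=> /ereal_inf_lt[_ [delta /= delta0 <-]] w_gt.
  apply: ge_ereal_sup => _ [t /= t0 <-].
  have [|x [y [txy phixy]]] :=
    @exists_far_pair_close_images R p q _ _ _ _ mu _ _ nu phi w delta t
      hq hqp infLp delta0.
    move=> x y xy; rewrite -lee_fin; apply/ltW/(le_lt_trans _ w_gt).
    by apply: ereal_sup_ubound; exists (x, y).
  apply: (@le_trans _ _ (mdist (phi x) (phi y))%:E); last by rewrite lee_fin.
  by apply: ereal_inf_lbound; exists (x, y).
rewrite /separation_ratio.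
(* When [omega phi] is infinite the ratio is 0. *)
case: (omega phi) omega0 kappa_le => [w||//] => w0 kappa_le; last first.
  by rewrite invey mule0 lee_fin.
have kw : (kappa phi <= (w *+ 4)%:E)%E.
  apply/lee_addgt0Pr => eps eps0.
  apply: le_trans (kappa_le (w + eps / 4) _) _.
    by rewrite lte_fin ltrDl divr_gt0.
  rewrite -EFinD lee_fin; lra.
rewrite lee_fin le_eqVlt in w0.
have [w00|w_gt0] := predU1P w0.
  (* Here [omega phi] is 0, whose inverse is [+oo]; but [kappa phi] is at most 0, so the product is
     at most 0. *)
  rewrite -w00 mul0rn in kw; rewrite -w00.
  apply: (@le_trans _ _ 0%E); last by rewrite lee_fin.
  by rewrite inve0; apply: mule_le0_ge0; rewrite ?leey.
rewrite inver gt_eqF// lee_pdivrMr//.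
(* For finite positive [omega phi] the ratio is at most 4. *)
by apply: le_trans kw _; rewrite -EFinM lee_fin; lra.
Qed.
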